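(* Let $M,n\ge 1$ and let $f^i_m:\mathbb{R}^d\to\mathbb{R}$ ($m\in[M]$, $i\in[n]$) be differentiable, convex and $L$-smooth, with $f_m=\frac1n\sum_{i=1}^n f^i_m$ and $f=\frac1M\sum_{m=1}^M f_m$. Assume $f$ is $L$-smooth and $\mu$-strongly convex with $\mu>0$, and let $x_*$ be its minimizer. Run Nastya (Random-Reshuffling option) with client stepsize $\gamma>0$, server stepsize $\eta$ and cohort size $C\in\{1,\dots,M\}$, where $\gamma n\le \eta\le \frac{1}{16L}$. Then for every $T\ge 1$, $$\mathbb{E}\big[\|x_T-x_*\|^2\big]\le \Big(1-\frac{\eta\mu}{2}\Big)^T\|x_0-x_*\|^2+\frac{5\gamma^2 nL}{\mu}\Big(\frac1M\sum_{m=1}^M\sigma_{*,m}^2+n\sigma_*^2\Big)+\frac{8\eta}{\mu}\cdot\frac{M-C}{C\max\{M-1,1\}}\,\sigma_*^2 .$$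
   Context: Here $[k]=\{1,\dots,k\}$. A function $h$ is $L$-smooth if $\|\nabla h(x)-\nabla h(y)\|\le L\|x-y\|$ for all $x,y$. Algorithm Nastya (Random-Reshuffling option), with inputs $\gamma>0$, $\eta\ge0$, $C\in\{1,\dots,M\}$, $x_0\in\mathbb{R}^d$. For each round $t=0,1,\dots,T-1$: (i) sample a cohort $S_t\subseteq[M]$ uniformly at random among all subsets of cardinality $C$; (ii) for each $m\in S_t$, sample a permutation $\pi_m=(\pi_m^0,\dots,\pi_m^{n-1})$ of $[n]$ uniformly at random, and set $x^0_{t,m}=x_t$ and $x^{i+1}_{t,m}=x^i_{t,m}-\gamma\nabla f_m^{\pi_m^i}(x^i_{t,m})$ for $i=0,\dots,n-1$; (iii) set $g_{t,m}=\frac{1}{\gamma n}(x_t-x^n_{t,m})$, $g_t=\frac1C\sum_{m\in S_t}g_{t,m}$ and $x_{t+1}=x_t-\eta g_t$. All samplings (cohorts and permutations, across clients and rounds) are mutually independent and independent of the past. Notation: $\sigma_*^2=\frac1M\sum_{m=1}^M\|\nabla f_m(x_* )\|^2$ and $\sigma_{*,m}^2=\frac1n\sum_{i=1}^n\|\nabla f^i_m(x_* )\|^2$. *)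

(* Defs.v *)
From HB Require Import structures.
From mathcomp Require Import all_boot all_order all_algebra all_fingroup.
From mathcomp Require Import all_classical all_reals all_analysis.
Set Implicit Arguments. Unset Strict Implicit. Unset Printing Implicit Defensive.
Import Order.TTheory GRing.Theory Num.Theory numFieldNormedType.Exports.
Local Open Scope ring_scope.

Section Defs.
Variables (R : realType) (d : nat).
Notation V := 'rV[R]_d.

Definition dotv (u v : V) : R := \sum_(i < d) u 0 i * v 0 i.
Definition sqnorm (u : V) : R := dotv u u.
Definition enorm (u : V) : R := Num.sqrt (sqnorm u).

Definition grad (h : V -> R) (x : V) : V :=
  \row_(i < d) ('D_(delta_mx 0 i : V) h x).

Definition differentiable_everywhere (h : V -> R) : Prop :=
  forall x : V, differentiable h x.

Definition smooth (L : R) (h : V -> R) : Prop :=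
  forall x y : V, enorm (grad h x - grad h y) <= L * enorm (x - y).

Definition convex_fun (h : V -> R) : Prop :=
  forall (x y : V) (t : R), 0 <= t <= 1 ->
    h (t *: x + (1 - t) *: y) <= t * h x + (1 - t) * h y.

Definition strongly_convex (mu : R) (h : V -> R) : Prop :=
  forall (x y : V) (t : R), 0 <= t <= 1 ->
    h (t *: x + (1 - t) *: y)
      <= t * h x + (1 - t) * h y - mu / 2 * t * (1 - t) * sqnorm (x - y).

End Defs.

Section Nastya.
Variables (R : realType) (d M n : nat).
Variable F : 'I_M -> 'I_n -> 'rV[R]_d -> R.
Notation V := 'rV[R]_d.

Definition fm (m : 'I_M) : V -> R := fun x => n%:R^-1 * \sum_(i < n) F m i x.
Definition ftot : V -> R := fun x => M%:R^-1 * \sum_(m < M) fm m x.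

Definition sigma_star2 (xs : V) : R := M%:R^-1 * \sum_(m < M) sqnorm (grad (fm m) xs).
Definition sigma_star_m2 (xs : V) (m : 'I_M) : R :=
  n%:R^-1 * \sum_(i < n) sqnorm (grad (F m i) xs).

Definition local_run (gamma : R) (m : 'I_M) (pi : 'S_n) (x : V) : V :=
  foldl (fun y (i : 'I_n) => y - gamma *: grad (F m (pi i)) y) x (enum 'I_n).

(* Outcome of the randomness of one round: a cohort and a permutation for
   every client (only those of cohort members are used). *)
Definition round_outcome := ({set 'I_M} * {ffun 'I_M -> 'S_n})%type.

Definition valid_outcome (C : nat) (o : round_outcome) : bool := #|o.1| == C.

Definition nastya_step (gamma eta : R) (C : nat) (x : V) (o : round_outcome) : V :=
  let g_m := fun m => (gamma * n%:R)^-1 *: (x - local_run gamma m (o.2 m) x) in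
  let g := C%:R^-1 *: \sum_(m in o.1) g_m m in
  x - eta *: g.

Definition nastya_iterate (gamma eta : R) (C T : nat) (x0 : V)
    (w : {ffun 'I_T -> round_outcome}) : V :=
  foldl (nastya_step gamma eta C) x0 [seq w t | t <- enum 'I_T].

(* Expectation of a function of the T rounds' randomness, under the uniform
   law on (uniform cohorts of size C) x (uniform permutations), independent
   across rounds: the uniform average over all valid outcome sequences. *)
Definition valid_seq (C T : nat) (w : {ffun 'I_T -> round_outcome}) : bool :=
  [forall t, valid_outcome C (w t)].

Definition expect (C T : nat) (X : {ffun 'I_T -> round_outcome} -> R) : R :=
  (\sum_(w : {ffun 'I_T -> round_outcome} | valid_seq C w) X w)
    / #|[pred w : {ffun 'I_T -> round_outcome} | valid_seq C w]|%:R.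

End Nastya.

(* Main.v *)
Require Import Defs.
From mathcomp Require Import all_boot all_order all_algebra all_fingroup.
From mathcomp Require Import all_classical all_reals all_analysis.
From mathcomp Require Import ring lra zify.
Set Implicit Arguments. Unset Strict Implicit. Unset Printing Implicit Defensive.
Import Order.TTheory GRing.Theory Num.Theory numFieldNormedType.Exports.
Local Open Scope ring_scope.

(** One round is analysed through the Bregman divergences of the component functions
    between [xs] and the local iterates. The three-point identity turns the inner
    product of the server direction with [x - xs] into [f x - f xs] plus the mean
    divergence, minus the mean drift of the local iterates. Since
    [|grad h u - grad h v|^2] is at most [2 L] times the divergence of [h], the squared
    norm of the direction, its cohort variance and the drift are all bounded by a small
    multiple of the mean divergence plus noise at [xs], so that divergence absorbs them,
    and strong convexity gives the contraction factor [1 - eta mu]. The noise is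
    estimated by the second moment of a sum over an exchangeable random set of fixed
    size, applied both to cohorts and to the prefixes of the random permutations. *)

(** * Uniform averages *)

Definition mean (R : numFieldType) (I : finType) (A : pred I) (f : I -> R) : R :=
  #|A|%:R^-1 * \sum_(i | A i) f i.

Notation "\E_ i F" := (mean xpredT (fun i => F))
  (at level 34, i at level 0, F at level 41, right associativity) : ring_scope.
Notation "\E_ ( i | P ) F" := (mean (fun i => P%B) (fun i => F))
  (at level 34, F at level 41, i, P at level 50) : ring_scope.
Notation "\E_ ( i : t | P ) F" := (mean (fun i : t => P%B) (fun i : t => F))
  (at level 34, F at level 41, i, P at level 50, only parsing) : ring_scope.
Notation "\E_ ( i : t ) F" := (mean xpredT (fun i : t => F))
  (at level 34, F at level 41, i at level 50, only parsing) : ring_scope.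
Notation "\E_ ( i < n ) F" := (mean xpredT (fun i : 'I_n => F))
  (at level 34, F at level 41, i, n at level 50) : ring_scope.

Section Mean.
Context {R : numFieldType}.
Implicit Types (I J : finType).

Lemma eq_mean I (A : pred I) (f g : I -> R) :
  (forall i, A i -> f i = g i) -> \E_(i | A i) f i = \E_(i | A i) g i.
Proof. by move=> fg; congr (_ * _); exact: eq_bigr. Qed.

Lemma mean_ord n (f : 'I_n -> R) : \E_(i < n) f i = n%:R^-1 * \sum_(i < n) f i.
Proof. by rewrite /mean (card_ord n). Qed.

Lemma ge0_mean I (A : pred I) (f : I -> R) :
  (forall i, A i -> 0 <= f i) -> 0 <= \E_(i | A i) f i.
Proof. by move=> f0; rewrite mulr_ge0 ?invr_ge0 ?sumr_ge0. Qed.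

Lemma le_mean I (A : pred I) (f g : I -> R) :
  (forall i, A i -> f i <= g i) -> \E_(i | A i) f i <= \E_(i | A i) g i.
Proof. by move=> fg; rewrite ler_wpM2l ?invr_ge0 ?ler_sum. Qed.

Lemma meanD I (A : pred I) (f g : I -> R) :
  \E_(i | A i) (f i + g i) = \E_(i | A i) f i + \E_(i | A i) g i.
Proof. by rewrite /mean big_split mulrDr. Qed.

Lemma meanZ I (A : pred I) c (f : I -> R) :
  \E_(i | A i) (c * f i) = c * \E_(i | A i) f i.
Proof. by rewrite /mean -mulr_sumr mulrCA. Qed.

Lemma meanB I (A : pred I) (f g : I -> R) :
  \E_(i | A i) (f i - g i) = \E_(i | A i) f i - \E_(i | A i) g i.
Proof. by rewrite /mean sumrB mulrBr. Qed.

Lemma mean_cst I (A : pred I) (c : R) : (0 < #|A|)%N -> \E_(i | A i) c = c.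
Proof.
by move=> A0; rewrite /mean sumr_const -[c *+ _]mulr_natl mulKf// pnatr_eq0 -lt0n.
Qed.

Lemma mean_ord_cst n (c : R) : (0 < n)%N -> \E_(i < n) c = c.
Proof. by move=> n_gt0; rewrite mean_cst// card_ord. Qed.

Lemma mean_sumr I (A : pred I) (J : Type) (r : seq J) (P : pred J) (f : I -> J -> R) :
  \E_(i | A i) (\sum_(j <- r | P j) f i j) = \sum_(j <- r | P j) \E_(i | A i) f i j.
Proof. by rewrite /mean exchange_big mulr_sumr. Qed.

Lemma exchange_mean I J (A : pred I) (B : pred J) (f : I -> J -> R) :
  \E_(i | A i) \E_(j | B j) f i j = \E_(j | B j) \E_(i | A i) f i j.
Proof. by rewrite /mean -!mulr_sumr exchange_big mulrCA. Qed.

Lemma mean_pair I J (A : pred I) (B : pred J) (f : I * J -> R) :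
  \E_(p | A p.1 && B p.2) f p = \E_(i | A i) \E_(j | B j) f (i, j).
Proof.
have cardAB : #|fun p : I * J => A p.1 && B p.2| = (#|A| * #|B|)%N.
  by rewrite -cardX; apply: eq_card.
rewrite /mean cardAB natrM invfM -mulr_sumr mulrA pair_big.
by congr (_ * _); apply: eq_bigr => -[].
Qed.

Lemma mean_reindex I J (h : J -> I) (A : pred I) (f : I -> R) :
  bijective h -> \E_(i | A i) f i = \E_(j | A (h j)) f (h j).
Proof.
move=> bij_h; rewrite /mean -!sum1_card.
by rewrite !(reindex h (onW_bij _ bij_h)).
Qed.

Lemma mean_reindex_inj I (h : I -> I) (A : pred I) (f : I -> R) :
  injective h -> (forall i, A (h i) = A i) ->
  \E_(i | A i) f (h i) = \E_(i | A i) f i.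
Proof.
move=> inj_h Ah; rewrite [RHS](mean_reindex _ _ (injF_bij inj_h)) /mean.
by rewrite (eq_card Ah) (eq_bigl _ _ Ah).
Qed.

End Mean.

(** * Euclidean geometry *)

Section InnerProduct.
Context {R : realType} {d : nat}.
Notation V := 'rV[R]_d.
Implicit Types (u v w : V) (c : R).

Lemma dotvC u v : dotv u v = dotv v u.
Proof. by apply: eq_bigr => i _; rewrite mulrC. Qed.

Lemma dotvDl u v w : dotv (u + v) w = dotv u w + dotv v w.
Proof. by rewrite -big_split; apply: eq_bigr => i _; rewrite mxE mulrDl. Qed.

Lemma dotvZl c u v : dotv (c *: u) v = c * dotv u v.
Proof. by rewrite mulr_sumr; apply: eq_bigr => i _; rewrite mxE mulrA. Qed.

Lemma dotvNl u v : dotv (- u) v = - dotv u v.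
Proof. by rewrite -scaleN1r dotvZl mulN1r. Qed.

Lemma dotvBl u v w : dotv (u - v) w = dotv u w - dotv v w.
Proof. by rewrite dotvDl dotvNl. Qed.

Lemma dotv0l v : dotv 0 v = 0.
Proof. by rewrite -(scale0r (0 : V)) dotvZl mul0r. Qed.

Lemma dotvDr u v w : dotv u (v + w) = dotv u v + dotv u w.
Proof. by rewrite !(dotvC u) dotvDl. Qed.

Lemma dotvZr c u v : dotv u (c *: v) = c * dotv u v.
Proof. by rewrite !(dotvC u) dotvZl. Qed.

Lemma dotvNr u v : dotv u (- v) = - dotv u v.
Proof. by rewrite !(dotvC u) dotvNl. Qed.

Lemma dotvBr u v w : dotv u (v - w) = dotv u v - dotv u w.
Proof. by rewrite dotvDr dotvNr. Qed.

Lemma dotv_suml (I : Type) (r : seq I) (P : pred I) (a : I -> V) v :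
  dotv (\sum_(i <- r | P i) a i) v = \sum_(i <- r | P i) dotv (a i) v.
Proof. by elim/big_rec2: _ => [|i s t _ <-]; rewrite ?dotv0l ?dotvDl. Qed.

Lemma dotv_sumr (I : Type) (r : seq I) (P : pred I) (a : I -> V) v :
  dotv v (\sum_(i <- r | P i) a i) = \sum_(i <- r | P i) dotv v (a i).
Proof. by rewrite dotvC dotv_suml; apply: eq_bigr => i _; rewrite dotvC. Qed.

Lemma sqnorm_ge0 u : 0 <= sqnorm u.
Proof. by apply: sumr_ge0 => i _; rewrite -expr2 sqr_ge0. Qed.

Lemma sqnorm0 : sqnorm (0 : V) = 0.
Proof. exact: dotv0l. Qed.

Lemma sqnormD u v : sqnorm (u + v) = sqnorm u + 2 * dotv u v + sqnorm v.
Proof. by rewrite /sqnorm !dotvDl !dotvDr (dotvC v u); ring. Qed.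

Lemma sqnormN u : sqnorm (- u) = sqnorm u.
Proof. by rewrite /sqnorm dotvNl dotvNr opprK. Qed.

Lemma sqnormB u v : sqnorm (u - v) = sqnorm u - 2 * dotv u v + sqnorm v.
Proof. by rewrite sqnormD sqnormN dotvNr mulrN. Qed.

Lemma sqnormZ c u : sqnorm (c *: u) = c ^+ 2 * sqnorm u.
Proof. by rewrite /sqnorm dotvZl dotvZr expr2 mulrA. Qed.

Lemma sqnorm_eq0 u : (sqnorm u == 0) = (u == 0).
Proof.
apply/eqP/eqP => [/eqP|->]; last exact: sqnorm0.
rewrite psumr_eq0 => [/allP u0|i _]; last by rewrite -expr2 sqr_ge0.
apply/rowP => i; rewrite mxE.
by have := u0 i (mem_index_enum i); rewrite /= -expr2 sqrf_eq0 => /eqP.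
Qed.

Lemma sqnormD_le u v : sqnorm (u + v) <= 2 * sqnorm u + 2 * sqnorm v.
Proof. by have := sqnorm_ge0 (u - v); rewrite sqnormB sqnormD; lra. Qed.

Lemma enorm_ge0 u : 0 <= enorm u.
Proof. exact: sqrtr_ge0. Qed.

Lemma sqr_enorm u : enorm u ^+ 2 = sqnorm u.
Proof. by rewrite sqr_sqrtr// sqnorm_ge0. Qed.

Lemma enormZ c u : 0 <= c -> enorm (c *: u) = c * enorm u.
Proof.
by move=> c_ge0; rewrite /enorm sqnormZ sqrtrM ?sqr_ge0// sqrtr_sqr ger0_norm.
Qed.

Lemma dotv_le_enorm u v : dotv u v <= enorm u * enorm v.
Proof.
have [u0|u0] := eqVneq u 0; first by rewrite u0 dotv0l mulr_ge0 ?enorm_ge0.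
have [v0|v0] := eqVneq v 0; first by rewrite v0 dotvC dotv0l mulr_ge0 ?enorm_ge0.
have uv_gt0 : 0 < enorm u * enorm v.
  by rewrite mulr_gt0// sqrtr_gt0 lt0r sqnorm_ge0 sqnorm_eq0 ?u0 ?v0.
have := sqnorm_ge0 (enorm v *: u - enorm u *: v).
rewrite sqnormB !sqnormZ !sqr_enorm dotvZl dotvZr -!sqr_enorm => sq_ge0.
rewrite -subr_ge0 -(pmulr_rge0 _ uv_gt0); nra.
Qed.

End InnerProduct.

Section Barycenter.
Context {R : realType} {d : nat} {I : finType}.
Notation V := 'rV[R]_d.
Implicit Types (a : I -> V) (v : V).

Definition barycenter a : V := #|I|%:R^-1 *: \sum_i a i.

Lemma barycenterB a b :
  barycenter (fun i => a i - b i) = barycenter a - barycenter b.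
Proof. by rewrite /barycenter sumrB scalerBr. Qed.

Lemma barycenter_reindex_inj (h : I -> I) a :
  injective h -> barycenter (fun i => a (h i)) = barycenter a.
Proof. by move=> inj_h; congr (_ *: _); rewrite [RHS](reindex_inj inj_h). Qed.

Lemma dotv_barycenterl a v : dotv (barycenter a) v = \E_i dotv (a i) v.
Proof. by rewrite dotvZl dotv_suml. Qed.

Lemma sum_barycenter a : \sum_i a i = #|I|%:R *: barycenter a.
Proof.
have [I0|I0] := eqVneq #|I| 0%N; last by rewrite scalerKV// pnatr_eq0.
by rewrite I0 scale0r big_pred0// => i; have := card0_eq I0 i.
Qed.

Lemma sum_center_eq0 a : \sum_i (a i - barycenter a) = 0.
Proof. by rewrite sumrB sumr_const sum_barycenter scaler_nat subrr. Qed.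

Lemma mean_sqnorm_center a :
  \E_i sqnorm (a i - barycenter a) = \E_i sqnorm (a i) - sqnorm (barycenter a).
Proof.
have [I0|I_gt0] := posnP #|I|.
  rewrite /barycenter /mean; rewrite !(big_pred0 _ _ _ _ (card0_eq I0)).
  by rewrite scaler0 mulr0 sqnorm0 subr0.
under eq_mean => i _ do rewrite sqnormB.
rewrite meanD meanB meanZ -dotv_barycenterl mean_cst// -/(sqnorm _); lra.
Qed.

Lemma mean_sqnorm_center_le a :
  \E_i sqnorm (a i - barycenter a) <= \E_i sqnorm (a i).
Proof. by rewrite mean_sqnorm_center gerBl sqnorm_ge0. Qed.

Lemma sqnorm_barycenter_le a : sqnorm (barycenter a) <= \E_i sqnorm (a i).
Proof.
by rewrite -subr_ge0 -mean_sqnorm_center ge0_mean// => i _; exact: sqnorm_ge0.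
Qed.

Lemma sqnorm_sum_le (P : pred I) a :
  sqnorm (\sum_(i | P i) a i) <= #|I|%:R ^+ 2 * \E_i sqnorm (a i).
Proof.
rewrite big_mkcond sum_barycenter sqnormZ ler_wpM2l ?sqr_ge0//.
apply: le_trans (sqnorm_barycenter_le _) (le_mean _) => i _.
by case: ifP => // _; rewrite sqnorm0 sqnorm_ge0.
Qed.

End Barycenter.

(** * Smooth convex functions *)

Section Gradient.
Context {R : realType} {d : nat}.
Notation V := 'rV[R]_d.
Implicit Types (h : V -> R) (v x y : V) (t : R).

Lemma derive_dotv h x v : differentiable h x -> 'D_v h x = dotv (grad h x) v.
Proof.
move=> diff_h; rewrite deriveE// {1}(row_sum_delta v) linear_sum.
by apply: eq_bigr => i _; rewrite linearZ/= mxE deriveE// mulrC.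
Qed.

Lemma is_derive_line h x v t : differentiable h (x + t *: v) ->
  is_derive t 1 (fun s => h (x + s *: v)) (dotv (grad h (x + t *: v)) v).
Proof.
move=> diff_h; have lineE :
    (fun e => e^-1 *: (h (x + (e *: 1 + t) *: v) - h (x + t *: v))) =
    (fun e => e^-1 *: (h (e *: v + (x + t *: v)) - h (x + t *: v))).
  by apply/funext => e; rewrite [e *: 1]mulr1 scalerDl addrCA.
split; last by rewrite -derive_dotv// /derive /= lineE.
by rewrite /derivable /= lineE; exact: diff_derivable.
Qed.

Lemma grad_min_eq0 h x : differentiable_everywhere h ->
  (forall y, h x <= h y) -> grad h x = 0.
Proof.
move=> diff_h x_min; apply/eqP; rewrite -sqnorm_eq0.
set g := grad h x; pose line t := h (x + t *: g).
have is_derive_line_h t : is_derive t 1 line (dotv (grad h (x + t *: g)) g).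
  exact: is_derive_line.
have line_min0 : is_derive (0 : R) 1 line 0.
  apply: (@derive1_at_min _ _ (-1) 1) => [|t _||t _].
  - lra.
  - by have [] := is_derive_line_h t.
  - by rewrite in_itv/= ltrN10 ltr01.
  - by rewrite /line scale0r addr0.
have := @derive_val _ _ _ _ _ _ _ (is_derive_line_h 0).
by rewrite (@derive_val _ _ _ _ _ _ _ line_min0) scale0r addr0 => /esym/eqP.
Qed.

Lemma convex_grad_le h x y : differentiable h x -> convex_fun h ->
  dotv (grad h x) (y - x) <= h y - h x.
Proof.
move=> diff_h convex_h; rewrite -derive_dotv//.
have derivable_h : derivable h x (y - x) by exact: diff_derivable.
apply: (cvgr_to_le (cvg_dnbhs_at_right derivable_h)); near=> t.
have t_gt0 : 0 < t by [].
have t_le1 : t <= 1 by near: t; apply: nbhs_right_le.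
have -> /= : (h \o shift x) (t *: (y - x)) = h (t *: y + (1 - t) *: x).
  by congr h; rewrite /= scalerBr scalerBl scale1r -addrA (addrC x).
rewrite [_ *: _]mulrC ler_pdivrMr//.
by have := convex_h y x t; rewrite (ltW t_gt0) t_le1 => /(_ isT); lra.
Unshelve. all: by end_near. Qed.

Lemma strongly_convex_min mu h x y : strongly_convex mu h ->
  (forall z, h x <= h z) -> mu / 2 * sqnorm (y - x) <= h y - h x.
Proof.
move=> sconvex_h x_min.
have near1_le t : 0 < t <= 1 -> (1 - t) * (mu / 2 * sqnorm (y - x)) <= h y - h x.
  move=> /andP[t_gt0 t_le1]; rewrite -(ler_pM2l t_gt0).
  have := sconvex_h y x t; rewrite (ltW t_gt0) t_le1 => /(_ isT).
  by have := x_min (t *: y + (1 - t) *: x); lra.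
set a := mu / 2 * _ in near1_le *.
have cvg_a : ((fun t : R => (1 - t) * a) @ 0^'+ --> (1 - 0) * a)%classic.
  apply: cvg_at_right_filter; apply: cvgMl.
  by apply: cvgB; [exact: cvg_cst|exact: cvg_id].
rewrite -[a]mul1r -[1 in X in X <= _]subr0.
apply: (cvgr_to_le cvg_a); near=> t; apply: near1_le; apply/andP; split=> //.
by near: t; apply: nbhs_right_le.
Unshelve. all: by end_near. Qed.

Lemma mean_fctE n (F : 'I_n -> V -> R) :
  (fun x => \E_i F i x) = n%:R^-1 \*: (\sum_i F i).
Proof. by apply/funext => x; rewrite mean_ord fct_sumE. Qed.

Lemma differentiable_mean n (F : 'I_n -> V -> R) x :
  (forall i, differentiable (F i) x) -> differentiable (fun y => \E_i F i y) x.
Proof.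
move=> diff_F; rewrite mean_fctE.
by apply: differentiableZ; apply: differentiable_sum.
Qed.

Lemma grad_mean n (F : 'I_n -> V -> R) x : (forall i, differentiable (F i) x) ->
  grad (fun y => \E_i F i y) x = barycenter (fun i => grad (F i) x).
Proof.
move=> diff_F; rewrite mean_fctE; apply/rowP => j.
have derivable_F i v : derivable (F i) x v by exact: diff_derivable.
rewrite !mxE summxE card_ord deriveZ; last exact: derivable_sum.
by rewrite derive_sum//; congr (_ * _); apply: eq_bigr => i _; rewrite mxE.
Qed.

End Gradient.

Section Bregman.
Context {R : realType} {d : nat}.
Notation V := 'rV[R]_d.
Variable h : V -> R.
Implicit Types (x y z : V) (L : R).

Definition bregman x y := h x - h y - dotv (grad h y) (x - y).

Lemma dotv_grad_bregman x y z :
  dotv (grad h y) (x - z) = h x - h z + bregman z y - bregman x y.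
Proof. by rewrite /bregman !dotvBr; lra. Qed.

Lemma bregman_three_points x y z :
  bregman z y = bregman z x + bregman x y + dotv (grad h x - grad h y) (z - x).
Proof. by rewrite /bregman !dotvBl !dotvBr; lra. Qed.

Lemma bregman_ge0 x y : differentiable h y -> convex_fun h -> 0 <= bregman x y.
Proof. by move=> diff_h convex_h; rewrite subr_ge0 convex_grad_le. Qed.

Lemma bregman_le_sqnorm L x y : differentiable_everywhere h -> smooth L h ->
  bregman x y <= L / 2 * sqnorm (x - y).
Proof.
move=> diff_h smooth_h; set v := x - y.
pose gap : R -> R := (fun t => h (y + t *: v)) -
  dotv (grad h y) v \*: id - (L / 2 * sqnorm v) \*: id ^+ 2.
pose dgap t := dotv (grad h (y + t *: v)) v - dotv (grad h y) v - L * sqnorm v * t.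
have is_dgap t : is_derive t (1 : R) gap (dgap t).
  have dline := is_derive_line (v := v) (diff_h (y + t *: v)).
  by apply: is_derive_eq; rewrite /dgap expr1 /GRing.scale /=; field.
have dgap_le0 t : 0 <= t -> dgap t <= 0.
  move=> t_ge0; rewrite /dgap -dotvBl subr_le0.
  apply: le_trans (dotv_le_enorm _ _) _.
  have := smooth_h (y + t *: v) y; rewrite addrAC subrr add0r enormZ// => gradB_le.
  apply: le_trans (ler_wpM2r (enorm_ge0 v) gradB_le) _.
  by rewrite -sqr_enorm expr2; lra.
have [c] : exists2 c, c \in `]0, 1[%R & gap 1 - gap 0 = dgap c * (1 - 0).
  apply: MVT => //; apply: derivable_within_continuous => t _.
  by have [] := is_dgap t.
rewrite in_itv/= => /andP[c_gt0 _]; have := dgap_le0 c (ltW c_gt0).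
rewrite /gap !fctE /= !scale1r scale0r addr0 [y + v]addrC subrK expr1n expr0n.
by rewrite /GRing.scale /= /bregman -/v; lra.
Qed.

(* Nonnegativity of the divergence from [y] is used at the minimizer
   [x - (grad h x - grad h y) / L] of its quadratic upper bound around [x]. *)
Lemma sqnorm_gradB_le L x y : 0 < L ->
  differentiable_everywhere h -> convex_fun h -> smooth L h ->
  sqnorm (grad h y - grad h x) <= 2 * L * bregman x y.
Proof.
move=> L_gt0 diff_h convex_h smooth_h; rewrite -sqnormN opprB.
set g := grad h x - grad h y; pose z := x - L^-1 *: g.
have zx : z - x = - (L^-1 *: g) by rewrite /z addrAC subrr add0r.
have := bregman_le_sqnorm z x diff_h smooth_h.
have := bregman_ge0 z (diff_h y) convex_h.
rewrite (bregman_three_points x y z) zx dotvNr dotvZr sqnormN sqnormZ -/(sqnorm g).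
have -> : L / 2 * (L^-1 ^+ 2 * sqnorm g) = L^-1 * sqnorm g / 2.
  by field; rewrite gt_eqF.
by move=> z_ge z_le; rewrite -ler_pdivrMl ?mulr_gt0// invfM; lra.
Qed.

Lemma smoothness_lt_strong_convexity_eq mu L x y :
  differentiable_everywhere h -> smooth L h -> strongly_convex mu h ->
  (forall z, h y <= h z) -> L < mu -> x = y.
Proof.
move=> diff_h smooth_h sconvex_h y_min L_lt; apply/eqP; rewrite -subr_eq0 -sqnorm_eq0.
rewrite eq_le sqnorm_ge0 andbT -(@pmulr_rle0 _ (mu - L)) ?subr_gt0//.
have := strongly_convex_min x sconvex_h y_min.
have := bregman_le_sqnorm x y diff_h smooth_h.
by rewrite /bregman (grad_min_eq0 diff_h y_min) dotv0l; lra.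
Qed.

End Bregman.

(** * Sampling without replacement *)

Section Sampling.
Context {R : realType} {d : nat} {J Om : finType}.
Variables (A : pred Om) (U : Om -> {set J}) (k : nat).
Hypothesis A_gt0 : (0 < #|A|)%N.
Hypothesis card_U : forall w, A w -> #|U w| = k.
Hypothesis exchangeable : forall (s : {perm J}) (Phi : {set J} -> R),
  \E_(w | A w) Phi (s @: U w) = \E_(w | A w) Phi (U w).
Implicit Types (i j : J) (a : J -> 'rV[R]_d).

Local Notation N := (#|J|%:R : R).

Definition inclusion_prob j : R := \E_(w | A w) (j \in U w)%:R.

Definition joint_inclusion_prob i j : R :=
  \E_(w | A w) ((i \in U w) && (j \in U w))%:R.

Lemma joint_inclusion_prob_diag i : joint_inclusion_prob i i = inclusion_prob i.
Proof. by apply: eq_mean => w _; rewrite andbb. Qed.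

Lemma inclusion_prob_const i j : inclusion_prob i = inclusion_prob j.
Proof.
rewrite /inclusion_prob -(exchangeable (tperm i j) (fun B => (j \in B)%:R)).
apply: eq_mean => w _.
by rewrite -(mem_imset (U w) i (@perm_inj _ (tperm i j))) tpermL.
Qed.

Lemma joint_inclusion_prob_const i j j' : i != j -> i != j' ->
  joint_inclusion_prob i j = joint_inclusion_prob i j'.
Proof.
move=> ij ij'; pose both_in (B : {set J}) : R := ((i \in B) && (j' \in B))%:R.
rewrite /joint_inclusion_prob -(exchangeable (tperm j j') both_in).
apply: eq_mean => w _; pose inj_t := @perm_inj _ (tperm j j').
rewrite -(mem_imset (U w) i inj_t) -(mem_imset (U w) j inj_t).
by rewrite tpermL tpermD// eq_sym.
Qed.

Lemma sum_mem_sample w : A w -> \sum_j (j \in U w)%:R = k%:R :> R.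
Proof.
move=> Aw; rewrite -(card_U Aw) -sum1_card natr_sum [RHS]big_mkcond.
by apply: eq_bigr => j _; case: (j \in U w).
Qed.

Lemma inclusion_probE j : N * inclusion_prob j = k%:R.
Proof.
transitivity (\sum_i inclusion_prob i).
  under eq_bigr => i _ do rewrite (inclusion_prob_const i j).
  by rewrite sumr_const mulr_natl.
rewrite -mean_sumr -(mean_cst k%:R A_gt0); apply: eq_mean => w.
exact: sum_mem_sample.
Qed.

Lemma joint_inclusion_probE i j : i != j ->
  (N - 1) * joint_inclusion_prob i j = (k%:R - 1) * inclusion_prob i.
Proof.
move=> ij; transitivity (\sum_(j' | j' != i) joint_inclusion_prob i j').
  rewrite (eq_bigr (fun=> joint_inclusion_prob i j)) => [|j' ij']; last first.
    by apply: joint_inclusion_prob_const; rewrite // eq_sym.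
  rewrite sumr_const cardC1 -subn1 -[RHS]mulr_natl natrB//.
  by apply/card_gt0P; exists i.
rewrite -mean_sumr -meanZ; apply: eq_mean => w Aw.
rewrite -(sum_mem_sample Aw) [in RHS](bigD1 i)//=.
case: (i \in U w) => /=; last by rewrite mulr0 big1.
by rewrite mulr1 addrAC subrr add0r.
Qed.

Lemma mean_sampled_sum_prob (b : J -> R) :
  \E_(w | A w) \sum_(j in U w) b j = \sum_j inclusion_prob j * b j.
Proof.
under [LHS]eq_mean => w _ do rewrite big_mkcond.
rewrite mean_sumr; apply: eq_bigr => j _; rewrite mulrC -meanZ.
by apply: eq_mean => w _; case: ifP; rewrite ?mulr1 ?mulr0.
Qed.

Lemma mean_sampled_sum (b : J -> R) :
  \E_(w | A w) \sum_(j in U w) b j = k%:R * \E_j b j.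
Proof.
rewrite mean_sampled_sum_prob mulrCA !mulr_sumr; apply: eq_bigr => j _.
rewrite mulrA -(inclusion_probE j) mulrA mulVf ?mul1r// pnatr_eq0 -lt0n.
by apply/card_gt0P; exists j.
Qed.

Lemma mean_sqnorm_sampled_sum a :
  \E_(w | A w) sqnorm (\sum_(j in U w) a j) =
  \sum_i \sum_j joint_inclusion_prob i j * dotv (a i) (a j).
Proof.
under [RHS]eq_bigr => i _ do under eq_bigr => j _ do rewrite mulrC -meanZ.
under [RHS]eq_bigr => i _ do rewrite -mean_sumr.
rewrite -mean_sumr; apply: eq_mean => w _.
rewrite /sqnorm dotv_suml big_mkcond; apply: eq_bigr => i _.
rewrite dotv_sumr big_mkcond; case: (i \in U w) => /=; last first.
  by rewrite big1// => j _; rewrite mulr0.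
by apply: eq_bigr => j _; case: (j \in U w); rewrite ?mulr1 ?mulr0.
Qed.

Lemma sampling_varianceM a : \sum_j a j = 0 ->
  (N - 1) * \E_(w | A w) sqnorm (\sum_(j in U w) a j) =
  k%:R * (N - k%:R) * \E_j sqnorm (a j).
Proof.
move=> sum_a0; have offdiag i : \sum_(j | j != i) dotv (a i) (a j) = - sqnorm (a i).
  have := congr1 (dotv (a i)) sum_a0.
  rewrite dotv_sumr (bigD1 i)//= [dotv _ 0]dotvC dotv0l.
  by move/(canRL (addKr _)) => ->; rewrite addr0.
rewrite mean_sqnorm_sampled_sum mulr_sumr.
transitivity (\sum_i (N - k%:R) * inclusion_prob i * sqnorm (a i)).
  apply: eq_bigr => i _; rewrite (bigD1 i)//= joint_inclusion_prob_diag mulrDr.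
  have -> : (N - 1) * \sum_(j | j != i) joint_inclusion_prob i j * dotv (a i) (a j) =
      (k%:R - 1) * inclusion_prob i * - sqnorm (a i).
    rewrite -offdiag !mulr_sumr; apply: eq_bigr => j ji.
    by rewrite mulrA joint_inclusion_probE// eq_sym.
  by rewrite -/(sqnorm (a i)); ring.
rewrite (mulrC k%:R) -mulrA -mean_sampled_sum mean_sampled_sum_prob mulr_sumr.
by apply: eq_bigr => i _; rewrite mulrA.
Qed.

Lemma sampling_variance a : (k <= #|J|)%N -> \sum_j a j = 0 ->
  \E_(w | A w) sqnorm (\sum_(j in U w) a j) =
  k%:R * (#|J| - k)%:R / (maxn (#|J| - 1) 1)%:R * \E_j sqnorm (a j).
Proof.
move=> kJ sum_a0; have [J_le1|J_gt1] := leqP #|J| 1.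
  have a_eq0 j : a j = 0.
    rewrite -sum_a0 (big_pred1 j)// => i; apply/esym/eqP.
    by move/fintype_le1P: J_le1; exact.
  rewrite /mean !big1 ?mulr0// => [j _|w _]; first by rewrite a_eq0 sqnorm0.
  by rewrite big1 ?sqnorm0.
have N1_neq0 : N - 1 != 0 by rewrite subr_eq0 pnatr_eq1 gtn_eqF.
apply: (mulfI N1_neq0); rewrite sampling_varianceM// (maxn_idPl _) ?subn_gt0//.
by rewrite !natrB ?(ltnW J_gt1)//; field.
Qed.

Lemma sampling_bias_variance a :
  \E_(w | A w) sqnorm (\sum_(j in U w) a j) =
  k%:R ^+ 2 * sqnorm (barycenter a) +
    \E_(w | A w) sqnorm (\sum_(j in U w) (a j - barycenter a)).
Proof.
set c := barycenter a.
have cross0 : \E_(w | A w) \sum_(j in U w) dotv (a j - c) c = 0.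
  by rewrite mean_sampled_sum /mean -dotv_suml sum_center_eq0 dotv0l !mulr0.
transitivity (\E_(w | A w) (k%:R ^+ 2 * sqnorm c +
    2 * k%:R * (\sum_(j in U w) dotv (a j - c) c) +
    sqnorm (\sum_(j in U w) (a j - c)))).
  apply: eq_mean => w Aw.
  have -> : \sum_(j in U w) a j = k%:R *: c + \sum_(j in U w) (a j - c).
    by rewrite sumrB sumr_const (card_U Aw) scaler_nat addrC subrK.
  by rewrite sqnormD sqnormZ dotvZl dotv_sumr; under eq_bigr do rewrite dotvC; ring.
by rewrite !meanD mean_cst// meanZ cross0 mulr0 addr0.
Qed.

Lemma sampling_second_moment a : (k <= #|J|)%N ->
  \E_(w | A w) sqnorm (\sum_(j in U w) a j) <=
  k%:R ^+ 2 * sqnorm (barycenter a) +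
    k%:R * (#|J| - k)%:R / (maxn (#|J| - 1) 1)%:R * \E_j sqnorm (a j).
Proof.
move=> kJ; rewrite sampling_bias_variance (sampling_variance kJ (sum_center_eq0 a)).
by rewrite lerD2l ler_wpM2l ?divr_ge0 ?mulr_ge0// mean_sqnorm_center_le.
Qed.

Lemma sampled_step a v c : (0 < k <= #|J|)%N ->
  \E_(w | A w) sqnorm (v - c *: (k%:R^-1 *: \sum_(j in U w) a j)) <=
  sqnorm v - 2 * c * dotv (barycenter a) v + c ^+ 2 *
    (sqnorm (barycenter a) +
     (#|J| - k)%:R / (k%:R * (maxn (#|J| - 1) 1)%:R) * \E_j sqnorm (a j)).
Proof.
move=> /andP[k_gt0 kJ].
have stepE w : sqnorm (v - c *: (k%:R^-1 *: \sum_(j in U w) a j)) =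
    sqnorm v - 2 * c * k%:R^-1 * \sum_(j in U w) dotv (a j) v +
    (c * k%:R^-1) ^+ 2 * sqnorm (\sum_(j in U w) a j).
  by rewrite scalerA sqnormB sqnormZ dotvZr dotvC dotv_suml; ring.
under eq_mean => w _ do rewrite stepE.
rewrite meanD meanB mean_cst// !meanZ mean_sampled_sum -dotv_barycenterl.
have k_neq0 : k%:R != 0 :> R by rewrite pnatr_eq0 -lt0n.
have max_neq0 : (maxn (#|J| - 1) 1)%:R != 0 :> R.
  by rewrite pnatr_eq0 -lt0n leq_max orbT.
rewrite mulrA divfK// lerD2l.
set b := sqnorm _; set q := \E_j _; set g := (#|J| - k)%:R.
set r := (maxn _ _)%:R in max_neq0 *.
have -> : c ^+ 2 * (b + g / (k%:R * r) * q) =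
    (c * k%:R^-1) ^+ 2 * (k%:R ^+ 2 * b + k%:R * g / r * q).
  by field; rewrite max_neq0 k_neq0.
by apply: ler_wpM2l; [exact: sqr_ge0|exact: sampling_second_moment].
Qed.

End Sampling.

Section Exchangeability.
Context {R : numFieldType} {I J : finType}.
Implicit Types (s : {perm J}) (Phi : {set J} -> R).

Lemma fixed_card_exchangeable k s Phi :
  \E_(S : {set J} | #|S| == k) Phi (s @: S) =
  \E_(S : {set J} | #|S| == k) Phi S.
Proof.
rewrite (mean_reindex_inj _ (imset_inj (@perm_inj _ s)))// => S.
by rewrite card_imset//; exact: perm_inj.
Qed.

Lemma perm_image_exchangeable (i : I) (B : {set J}) s Phi :
  \E_(p : {ffun I -> {perm J}}) Phi (s @: (p i @: B)) =
  \E_(p : {ffun I -> {perm J}}) Phi (p i @: B).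
Proof.
pose compose (p : {ffun I -> {perm J}}) := [ffun j => (p j * s)%g].
have compose_inj : injective compose.
  move=> p q /ffunP pq; apply/ffunP => j.
  by have := pq j; rewrite !ffunE => /mulIg.
rewrite -[RHS](mean_reindex_inj _ compose_inj)//; apply: eq_mean => p _.
by rewrite ffunE -imset_comp; congr Phi; apply: eq_imset => j; rewrite /= permM.
Qed.

End Exchangeability.

(** * Independent rounds *)

Section Rounds.
Context {R : realFieldType} {O : finType}.
Variable A : pred O.

Definition ffun_cons T (o : O) (w : {ffun 'I_T -> O}) : {ffun 'I_T.+1 -> O} :=
  [ffun i => if unlift ord0 i is Some j then w j else o].

Lemma ffun_cons0 T o (w : {ffun 'I_T -> O}) : ffun_cons o w ord0 = o.
Proof. by rewrite ffunE unlift_none. Qed.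

Lemma ffun_consS T o (w : {ffun 'I_T -> O}) i : ffun_cons o w (lift ord0 i) = w i.
Proof. by rewrite ffunE liftK. Qed.

Lemma ffun_cons_bij T :
  bijective (fun ow : O * {ffun 'I_T -> O} => ffun_cons ow.1 ow.2).
Proof.
exists (fun w : {ffun 'I_T.+1 -> O} => (w ord0, [ffun i => w (lift ord0 i)])).
  move=> [] o w; rewrite ffun_cons0; congr pair.
  by apply/ffunP => i; rewrite ffunE ffun_consS.
move=> w; apply/ffunP => i; rewrite ffunE.
by case: unliftP => [j ->|->]; rewrite ?ffunE.
Qed.

Lemma all_ffun_cons T o (w : {ffun 'I_T -> O}) :
  [forall t, A (ffun_cons o w t)] = A o && [forall t, A (w t)].
Proof.
apply/forallP/andP => [all_A|[Ao /forallP all_A] t].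
  split; first by rewrite -(ffun_cons0 o w).
  by apply/forallP => t; rewrite -(ffun_consS o).
by rewrite ffunE; case: unliftP.
Qed.

Lemma map_ffun_cons T o (w : {ffun 'I_T -> O}) :
  [seq ffun_cons o w t | t <- enum 'I_T.+1] = o :: [seq w t | t <- enum 'I_T].
Proof.
rewrite enum_ordSl/= ffun_cons0 -map_comp; congr (_ :: _).
by apply: eq_map => i /=; rewrite ffun_consS.
Qed.

Lemma mean_ffun_recl T (f : {ffun 'I_T.+1 -> O} -> R) :
  \E_(w : {ffun 'I_T.+1 -> O} | [forall t, A (w t)]) f w =
  \E_(o | A o) \E_(w : {ffun 'I_T -> O} | [forall t, A (w t)]) f (ffun_cons o w).
Proof.
rewrite (mean_reindex _ _ (ffun_cons_bij T)).
rewrite -(mean_pair _ _ (fun ow => f (ffun_cons ow.1 ow.2))).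
by congr mean; apply/funext => ow; exact: all_ffun_cons.
Qed.

Lemma mean_foldl_contraction (X : Type) (step : X -> O -> X) (Phi : X -> R) a B T x :
  (0 < #|A|)%N -> 0 <= a ->
  (forall x, \E_(o | A o) Phi (step x o) <= a * Phi x + (1 - a) * B) ->
  \E_(w : {ffun 'I_T -> O} | [forall t, A (w t)])
    Phi (foldl step x [seq w t | t <- enum 'I_T])
  <= a ^+ T * Phi x + (1 - a ^+ T) * B.
Proof.
move=> A_gt0 a_ge0 step_le; elim: T x => [|T IH] x.
  rewrite (@eq_mean _ _ _ _ (fun=> Phi x)) => [|w _]; last first.
    by rewrite (size0nil (size_enum_ord 0)).
  rewrite mean_cst; first by rewrite expr0; lra.
  have /card_gt0P[i Ai] := A_gt0.
  by apply/card_gt0P; exists [ffun=> i]; apply/forallP => -[].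
rewrite mean_ffun_recl.
apply: (@le_trans _ _ (\E_(o | A o) (a ^+ T * Phi (step x o) + (1 - a ^+ T) * B))).
  apply: le_mean => o _; under eq_mean => w _ do rewrite map_ffun_cons.
  exact: IH.
rewrite meanD meanZ mean_cst// exprSr.
by have := ler_wpM2l (exprn_ge0 T a_ge0) (step_le x); lra.
Qed.

End Rounds.

(** * One local epoch *)

Section Epoch.
Context {R : realType} {d n : nat}.
Notation V := 'rV[R]_d.
Variables (h : 'I_n -> V -> R) (L gamma : R) (xs x : V).

Definition epoch_iterate (k : nat) : V :=
  foldl (fun y i => y - gamma *: grad (h i) y) x (take k (enum 'I_n)).

Definition epoch_direction : V := (gamma * n%:R)^-1 *: (x - epoch_iterate n).

Definition epoch_divergence : R := \E_i bregman (h i) xs (epoch_iterate i).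

Definition epoch_noise : R :=
  \E_(i < n) sqnorm (\sum_(j < n | (j < i)%N) grad (h j) xs).

Lemma epoch_iterateE k : (k <= n)%N -> epoch_iterate k =
  x - gamma *: \sum_(i < n | (i < k)%N) grad (h i) (epoch_iterate i).
Proof.
elim: k => [|k IH] kn.
  by rewrite /epoch_iterate take0 big_pred0// scaler0 subr0.
rewrite {1}/epoch_iterate (take_nth (Ordinal kn)) ?size_enum_ord// foldl_rcons.
rewrite -/(epoch_iterate k) (nth_ord_enum _ (Ordinal kn)).
rewrite [X in X - _](IH (ltnW kn)) -addrA -opprD -scalerDr; congr (_ - _ *: _).
rewrite [RHS](bigD1 (Ordinal kn))/= ?ltnS// addrC; congr (_ + _).
by apply: eq_bigl => i; rewrite ltnS (leq_eqVlt i) -val_eqE/=; lia.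
Qed.

Hypotheses (n_gt0 : (0 < n)%N) (L_gt0 : 0 < L) (gamma_gt0 : 0 < gamma).
Hypothesis diff_h : forall i, differentiable_everywhere (h i).
Hypothesis convex_h : forall i, convex_fun (h i).
Hypothesis smooth_h : forall i, smooth L (h i).

Lemma epoch_directionE :
  epoch_direction = barycenter (fun i => grad (h i) (epoch_iterate i)).
Proof.
rewrite /epoch_direction epoch_iterateE// opprB addrC subrK scalerA invfM.
rewrite mulrAC mulVf ?gt_eqF// mul1r /barycenter card_ord.
by congr (_ *: _); apply: eq_bigl => i; rewrite ltn_ord.
Qed.

Lemma epoch_divergence_ge0 : 0 <= epoch_divergence.
Proof. by apply: ge0_mean => i _; apply: bregman_ge0 => //; exact: diff_h. Qed.

Lemma mean_sqnorm_gradB_le :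
  \E_i sqnorm (grad (h i) (epoch_iterate i) - grad (h i) xs)
  <= 2 * L * epoch_divergence.
Proof. by rewrite -meanZ; apply: le_mean => i _; exact: sqnorm_gradB_le. Qed.

Lemma epoch_direction_dev :
  sqnorm (epoch_direction - barycenter (fun i => grad (h i) xs))
  <= 2 * L * epoch_divergence.
Proof.
rewrite epoch_directionE -barycenterB.
exact: le_trans (sqnorm_barycenter_le _) mean_sqnorm_gradB_le.
Qed.

Lemma epoch_drift :
  \E_(i < n) sqnorm (x - epoch_iterate i) <=
  4 * L * (gamma * n%:R) ^+ 2 * epoch_divergence + 2 * gamma ^+ 2 * epoch_noise.
Proof.
rewrite -[4 * L * _ * _](mean_ord_cst _ n_gt0) -[_ * epoch_noise]meanZ -meanD.
apply: le_mean => i _; rewrite epoch_iterateE ?(ltnW (ltn_ord i))//.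
rewrite opprB addrC subrK sqnormZ.
set G := \sum_(j < n | _) _; set Gs := \sum_(j < n | _) grad (h j) xs.
have GB_le : sqnorm (G - Gs) <= n%:R ^+ 2 * (2 * L * epoch_divergence).
  rewrite -sumrB (le_trans (sqnorm_sum_le _ _))// card_ord.
  by rewrite ler_wpM2l ?sqr_ge0// mean_sqnorm_gradB_le.
have := sqnormD_le (G - Gs) Gs; rewrite subrK => G_le.
have {GB_le}G_le :
    sqnorm G <= 4 * L * n%:R ^+ 2 * epoch_divergence + 2 * sqnorm Gs by lra.
have := ler_wpM2l (sqr_ge0 gamma) G_le; lra.
Qed.

Lemma epoch_progress : 2 * L * (gamma * n%:R) <= 1 ->
  \E_i (h i x - h i xs) + epoch_divergence / 2 - L * gamma ^+ 2 * epoch_noise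
  <= dotv epoch_direction (x - xs).
Proof.
move=> gamma_small.
have progress_drift : \E_i (h i x - h i xs) + epoch_divergence -
    L / 2 * \E_(i < n) sqnorm (x - epoch_iterate i) <= dotv epoch_direction (x - xs).
  rewrite epoch_directionE dotv_barycenterl -meanZ -meanD -meanB.
  apply: le_mean => i _; rewrite dotv_grad_bregman lerB//.
  exact: bregman_le_sqnorm.
apply: le_trans progress_drift.
have := ler_wpM2l (ltW L_gt0) epoch_drift.
have : (2 * L * (gamma * n%:R)) ^+ 2 * epoch_divergence <= epoch_divergence.
  rewrite ler_piMl ?epoch_divergence_ge0// exprn_ile1//.
  by rewrite !mulr_ge0 ?ler0n ?ltW.
rewrite exprMn exprMn; lra.
Qed.

End Epoch.

(** * Convergence of Nastya *)

Lemma card_ord_prefix n k : (k <= n)%N -> #|[set i : 'I_n | (i < k)%N]| = k.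
Proof.
move=> kn; rewrite -[RHS]card_ord -[RHS]sum1_card (big_ord_widen _ (fun=> 1%N) kn).
by rewrite -sum1_card; apply: eq_bigl => i; rewrite inE.
Qed.

Lemma cohorts_gt0 M C : (C <= M)%N -> (0 < #|fun S : {set 'I_M} => #|S| == C|)%N.
Proof. by move=> CM; rewrite -cardsE card_draws card_ord bin_gt0. Qed.

Lemma shufflings_gt0 M n : (0 < #|{ffun 'I_M -> 'S_n}|)%N.
Proof. by apply/card_gt0P; exists [ffun=> 1%g]. Qed.

Lemma mean_valid_outcome (R : numFieldType) M n C (f : round_outcome M n -> R) :
  \E_(o | valid_outcome C o) f o =
  \E_(S : {set 'I_M} | #|S| == C) \E_(p : {ffun 'I_M -> 'S_n}) f (S, p).
Proof.
rewrite -mean_pair; congr mean; apply/funext => o.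
by rewrite andbT.
Qed.

Lemma valid_outcome_gt0 M n C : (C <= M)%N -> (0 < #|@valid_outcome M n C|)%N.
Proof.
move=> /cohorts_gt0/card_gt0P[S SC].
by apply/card_gt0P; exists (S, [ffun=> 1%g]).
Qed.

Lemma expectE (R : realType) M n C T (X : {ffun 'I_T -> round_outcome M n} -> R) :
  expect C X =
  \E_(w : {ffun 'I_T -> round_outcome M n} | [forall t, valid_outcome C (w t)]) X w.
Proof. by rewrite /expect mulrC; congr (_%:R^-1 * _); apply: eq_card. Qed.

Section Server.
Context {R : realType} {d M n : nat}.
Notation V := 'rV[R]_d.
Notation shuffling := {ffun 'I_M -> 'S_n}.
Variables (F : 'I_M -> 'I_n -> V -> R) (L mu gamma eta : R) (C : nat) (xs : V).
Implicit Types (p : shuffling) (m : 'I_M) (x : V).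

Definition shuffled_loss p m (i : 'I_n) : V -> R := F m (p m i).

Definition client_direction p x m : V := epoch_direction (shuffled_loss p m) gamma x.

Definition client_divergence p x m : R :=
  epoch_divergence (shuffled_loss p m) gamma xs x.

Definition mean_divergence p x : R := \E_m client_divergence p x m.

Definition shuffling_noise p : R := \E_m epoch_noise (shuffled_loss p m) xs.

Definition gradient_noise : R :=
  M%:R^-1 * \sum_(m < M) sigma_star_m2 F xs m + n%:R * sigma_star2 F xs.

Definition cohort_factor : R := (M - C)%:R / (C%:R * (maxn (M - 1) 1)%:R).

Definition limit_error : R :=
  2 * gamma ^+ 2 * n%:R * L / mu * gradient_noise +
  2 * eta / mu * cohort_factor * sigma_star2 F xs.

Lemma fmE m : fm F m = fun x => \E_i F m i x.
Proof. by apply/funext => x; rewrite mean_ord. Qed.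

Lemma ftotE : ftot F = fun x => \E_m fm F m x.
Proof. by apply/funext => x; rewrite mean_ord. Qed.

Lemma sigma_star2E : sigma_star2 F xs = \E_m sqnorm (grad (fm F m) xs).
Proof. by rewrite mean_ord. Qed.

Lemma sigma_star_m2E m : sigma_star_m2 F xs m = \E_i sqnorm (grad (F m i) xs).
Proof. by rewrite mean_ord. Qed.

Lemma sigma_star2_ge0 : 0 <= sigma_star2 F xs.
Proof. by rewrite sigma_star2E ge0_mean// => m _; exact: sqnorm_ge0. Qed.

Lemma sigma_star_m2_ge0 m : 0 <= sigma_star_m2 F xs m.
Proof. by rewrite sigma_star_m2E ge0_mean// => i _; exact: sqnorm_ge0. Qed.

Lemma gradient_noise_ge0 : 0 <= gradient_noise.
Proof.
rewrite /gradient_noise -mean_ord.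
apply: addr_ge0; last by rewrite mulr_ge0 ?sigma_star2_ge0.
by apply: ge0_mean => m _; exact: sigma_star_m2_ge0.
Qed.

Lemma cohort_factor_ge0 : 0 <= cohort_factor.
Proof. by rewrite divr_ge0 ?mulr_ge0 ?ler0n. Qed.

Lemma cohort_factor_le1 : (0 < C)%N -> cohort_factor <= 1.
Proof.
move=> C_gt0; rewrite ler_pdivrMr; last first.
  by rewrite mulr_gt0// ltr0n// leq_max orbT.
by rewrite mul1r -natrM ler_nat; nia.
Qed.

Lemma local_runE p m x :
  local_run F gamma m (p m) x = epoch_iterate (shuffled_loss p m) gamma x n.
Proof. by rewrite /epoch_iterate take_oversize// size_enum_ord. Qed.

Lemma nastya_stepE p x (S : {set 'I_M}) :
  nastya_step F gamma eta C x (S, p) =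
  x - eta *: (C%:R^-1 *: \sum_(m in S) client_direction p x m).
Proof.
congr (_ - _ *: (_ *: _)); apply: eq_bigr => m _.
by rewrite /client_direction /epoch_direction -local_runE.
Qed.

Hypothesis n_gt0 : (0 < n)%N.
Hypothesis diff_F : forall m i, differentiable_everywhere (F m i).

Lemma differentiable_fm m : differentiable_everywhere (fm F m).
Proof. by move=> x; rewrite fmE; apply: differentiable_mean => i; exact: diff_F. Qed.

Lemma differentiable_ftot : differentiable_everywhere (ftot F).
Proof.
by move=> x; rewrite ftotE; apply: differentiable_mean => m; exact: differentiable_fm.
Qed.

Lemma grad_fm m x : grad (fm F m) x = barycenter (fun i => grad (F m i) x).
Proof. by rewrite fmE grad_mean// => i; exact: diff_F. Qed.

Lemma grad_ftot x : grad (ftot F) x = barycenter (fun m => grad (fm F m) x).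
Proof. by rewrite ftotE grad_mean// => m; exact: differentiable_fm. Qed.

Lemma grad_fm_shuffled p m x :
  barycenter (fun i => grad (shuffled_loss p m i) x) = grad (fm F m) x.
Proof.
rewrite grad_fm.
exact: (barycenter_reindex_inj (fun i => grad (F m i) x) (@perm_inj _ (p m))).
Qed.

Lemma mean_prefix_noise_le m (i : 'I_n) :
  \E_(p : shuffling)
    sqnorm (\sum_(j < n | (j < i)%N) grad (shuffled_loss p m j) xs) <=
  n%:R ^+ 2 * sqnorm (grad (fm F m) xs) + n%:R * sigma_star_m2 F xs m.
Proof.
pose prefix : {set 'I_n} := [set j : 'I_n | (j < i)%N].
have card_prefix (p : shuffling) : true -> #|p m @: prefix| = i.
  move=> _; rewrite card_imset; last exact: perm_inj.
  exact: card_ord_prefix (ltnW (ltn_ord i)).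
have prefix_sumE (p : shuffling) :
    \sum_(j < n | (j < i)%N) grad (shuffled_loss p m j) xs =
    \sum_(j in p m @: prefix) grad (F m j) xs.
  rewrite big_imset/=; last by move=> ? ? _ _; exact: perm_inj.
  by apply: eq_bigl => j; rewrite inE.
under eq_mean => p _ do rewrite prefix_sumE.
apply: le_trans (@sampling_second_moment R d _ _ xpredT _ _ (shufflings_gt0 M n)
  card_prefix (perm_image_exchangeable m prefix) (fun j => grad (F m j) xs) _) _.
  by rewrite card_ord ltnW.
rewrite card_ord -grad_fm -sigma_star_m2E.
rewrite lerD// ler_wpM2r ?sqnorm_ge0 ?sigma_star_m2_ge0//.
  by rewrite ler_pXn2r ?nnegrE// ler_nat ltnW.
rewrite ler_pdivrMr ?ltr0n ?leq_max ?orbT// -!natrM ler_nat.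
have [->|i_gt0] := posnP i; first by rewrite mul0n.
by apply: leq_mul; have := ltn_ord i; lia.
Qed.

Lemma mean_shuffling_noise_le : \E_p shuffling_noise p <= n%:R * gradient_noise.
Proof.
have -> : n%:R * gradient_noise = \E_(m < M) \E_(i < n)
    (n%:R ^+ 2 * sqnorm (grad (fm F m) xs) + n%:R * sigma_star_m2 F xs m).
  under eq_mean => m _ do rewrite mean_ord_cst//.
  rewrite meanD meanZ [X in _ + X]meanZ -sigma_star2E.
  by rewrite /gradient_noise -mean_ord; ring.
rewrite exchange_mean; apply: le_mean => m _.
by rewrite exchange_mean; apply: le_mean => i _; exact: mean_prefix_noise_le.
Qed.

Hypothesis convex_F : forall m i, convex_fun (F m i).
Hypothesis smooth_F : forall m i, smooth L (F m i).
Hypothesis sconvex_f : strongly_convex mu (ftot F).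
Hypothesis xs_min : forall y, ftot F xs <= ftot F y.
Hypotheses (L_gt0 : 0 < L) (gamma_gt0 : 0 < gamma).
Hypotheses (gamma_eta : gamma * n%:R <= eta) (eta_small : 6 * L * eta <= 1).

Let eta_gt0 : 0 < eta.
Proof. by apply: lt_le_trans gamma_eta; rewrite mulr_gt0// ltr0n. Qed.

Lemma mean_divergence_ge0 p x : 0 <= mean_divergence p x.
Proof.
apply: ge0_mean => m _.
by apply: epoch_divergence_ge0 => i; [exact: diff_F|exact: convex_F].
Qed.

Lemma client_direction_dev p x m :
  sqnorm (client_direction p x m - grad (fm F m) xs)
  <= 2 * L * client_divergence p x m.
Proof.
rewrite -(grad_fm_shuffled p).
by apply: epoch_direction_dev => // i; [exact: diff_F|exact: convex_F|exact: smooth_F].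
Qed.

Lemma sqnorm_mean_direction_le p x :
  sqnorm (barycenter (client_direction p x)) <= 2 * L * mean_divergence p x.
Proof.
have -> : barycenter (client_direction p x) =
    barycenter (fun m => client_direction p x m - grad (fm F m) xs).
  rewrite barycenterB -grad_ftot (grad_min_eq0 differentiable_ftot xs_min).
  by rewrite subr0.
apply: le_trans (sqnorm_barycenter_le _) _; rewrite -meanZ.
by apply: le_mean => m _; exact: client_direction_dev.
Qed.

Lemma mean_sqnorm_direction_le p x : \E_m sqnorm (client_direction p x m) <=
  4 * L * mean_divergence p x + 2 * sigma_star2 F xs.
Proof.
rewrite sigma_star2E -!meanZ -meanD; apply: le_mean => m _.
have := sqnormD_le (client_direction p x m - grad (fm F m) xs) (grad (fm F m) xs).
by rewrite subrK; have := client_direction_dev p x m; lra.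
Qed.

Lemma client_direction_progress p x m :
  fm F m x - fm F m xs + client_divergence p x m / 2
    - L * gamma ^+ 2 * epoch_noise (shuffled_loss p m) xs
  <= dotv (client_direction p x m) (x - xs).
Proof.
have gamma_small : 2 * L * (gamma * n%:R) <= 1.
  have := ler_wpM2l (ltW L_gt0) gamma_eta.
  by have := mulr_gt0 L_gt0 eta_gt0; move: eta_small; lra.
have -> : fm F m x - fm F m xs =
    \E_i (shuffled_loss p m i x - shuffled_loss p m i xs).
  rewrite !fmE -meanB.
  exact/esym/(mean_reindex_inj (fun i => F m i x - F m i xs) (@perm_inj _ (p m))).
by apply: epoch_progress => // i; [exact: diff_F|exact: convex_F|exact: smooth_F].
Qed.

Lemma mean_direction_progress p x :
  ftot F x - ftot F xs + mean_divergence p x / 2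
    - L * gamma ^+ 2 * shuffling_noise p
  <= dotv (barycenter (client_direction p x)) (x - xs).
Proof.
rewrite !ftotE [_ / 2]mulrC dotv_barycenterl -!meanZ -meanB -meanD -meanB.
apply: le_mean => m _; rewrite [_^-1 * _]mulrC; exact: client_direction_progress.
Qed.

Lemma direction_second_moment_le p x : (0 < C)%N ->
  sqnorm (barycenter (client_direction p x)) +
    cohort_factor * \E_m sqnorm (client_direction p x m) <=
  6 * L * mean_divergence p x + 2 * cohort_factor * sigma_star2 F xs.
Proof.
move=> C_gt0; have := sqnorm_mean_direction_le p x.
have := ler_wpM2l cohort_factor_ge0 (mean_sqnorm_direction_le p x).
have : cohort_factor * (L * mean_divergence p x) <= L * mean_divergence p x.
  by rewrite ler_piMl ?cohort_factor_le1// mulr_ge0 ?mean_divergence_ge0// ltW.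
lra.
Qed.

Lemma cohort_contraction p x : (0 < C <= M)%N ->
  \E_(S : {set 'I_M} | #|S| == C) sqnorm (nastya_step F gamma eta C x (S, p) - xs) <=
  (1 - eta * mu) * sqnorm (x - xs) + 2 * eta * L * gamma ^+ 2 * shuffling_noise p
    + 2 * eta ^+ 2 * cohort_factor * sigma_star2 F xs.
Proof.
move=> C_bounds; have /andP[C_gt0 CM] := C_bounds.
have cohort_card (S : {set 'I_M}) : #|S| == C -> #|S| = C by move/eqP.
have := sampled_step (cohorts_gt0 CM) cohort_card (fixed_card_exchangeable C)
  (client_direction p x) (x - xs) eta.
rewrite card_ord => /(_ C_bounds).
under [X in X <= _ -> _]eq_mean => S _ do rewrite addrAC -nastya_stepE.
move=> /le_trans; apply; rewrite -/cohort_factor.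
set D := mean_divergence p x.
have progress : mu / 2 * sqnorm (x - xs) + D / 2 - L * gamma ^+ 2 * shuffling_noise p
    <= dotv (barycenter (client_direction p x)) (x - xs).
  apply: le_trans (mean_direction_progress p x); rewrite lerD2r lerD2r.
  exact: strongly_convex_min.
have := direction_second_moment_le p x C_gt0; rewrite -/D => second_moment.
have := ler_wpM2l (ltW eta_gt0) progress.
have := ler_wpM2l (sqr_ge0 eta) second_moment.
have : 6 * L * eta * (eta * D) <= eta * D.
  by rewrite ler_piMl// mulr_ge0 ?mean_divergence_ge0// ltW.
lra.
Qed.

Hypothesis mu_gt0 : 0 < mu.

Lemma round_contraction x : (0 < C <= M)%N ->
  \E_(o | valid_outcome C o) sqnorm (nastya_step F gamma eta C x o - xs) <=
  (1 - eta * mu) * sqnorm (x - xs) + eta * mu * limit_error.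
Proof.
move=> C_bounds; rewrite mean_valid_outcome exchange_mean.
apply: le_trans (le_mean (fun p _ => cohort_contraction p x C_bounds)) _.
rewrite 2!meanD !mean_cst ?shufflings_gt0// meanZ.
have coef_ge0 : 0 <= 2 * eta * L * gamma ^+ 2 by rewrite !mulr_ge0 ?exprn_ge0// ltW.
have := ler_wpM2l coef_ge0 mean_shuffling_noise_le.
have -> : eta * mu * limit_error =
    2 * eta * L * gamma ^+ 2 * (n%:R * gradient_noise) +
    2 * eta ^+ 2 * cohort_factor * sigma_star2 F xs.
  by rewrite /limit_error; field; rewrite gt_eqF.
lra.
Qed.

Lemma shuffling_error_ge0 : 0 <= gamma ^+ 2 * n%:R * L / mu * gradient_noise.
Proof.
apply: mulr_ge0; last exact: gradient_noise_ge0.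
by rewrite divr_ge0 ?(ltW mu_gt0)// !mulr_ge0 ?exprn_ge0// ltW.
Qed.

Lemma cohort_error_ge0 : 0 <= eta / mu * cohort_factor * sigma_star2 F xs.
Proof.
apply: mulr_ge0 sigma_star2_ge0; apply: mulr_ge0 cohort_factor_ge0.
by rewrite divr_ge0// ltW.
Qed.

Lemma limit_error_ge0 : 0 <= limit_error.
Proof.
by have := shuffling_error_ge0; have := cohort_error_ge0; rewrite /limit_error; lra.
Qed.

Lemma limit_error_le : limit_error <=
  5 * gamma ^+ 2 * n%:R * L / mu * gradient_noise +
  8 * eta / mu * cohort_factor * sigma_star2 F xs.
Proof.
by have := shuffling_error_ge0; have := cohort_error_ge0; rewrite /limit_error; lra.
Qed.

Lemma nastya_convergence T x0 : (0 < C <= M)%N -> eta * mu <= 1 ->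
  expect C (fun w : {ffun 'I_T -> round_outcome M n} =>
    sqnorm (nastya_iterate F gamma eta C x0 w - xs)) <=
  (1 - eta * mu) ^+ T * sqnorm (x0 - xs) + limit_error.
Proof.
move=> C_bounds eta_mu; have /andP[_ CM] := C_bounds.
have rate_ge0 : 0 <= 1 - eta * mu by rewrite subr_ge0.
have contraction x :
    \E_(o | valid_outcome C o) sqnorm (nastya_step F gamma eta C x o - xs) <=
    (1 - eta * mu) * sqnorm (x - xs) + (1 - (1 - eta * mu)) * limit_error.
  by rewrite subKr; exact: round_contraction.
rewrite expectE.
apply: le_trans (mean_foldl_contraction (Phi := fun x => sqnorm (x - xs)) T x0
  (valid_outcome_gt0 n CM) rate_ge0 contraction) _.
by rewrite lerD2l ler_piMl ?limit_error_ge0// gerBl exprn_ge0.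
Qed.

End Server.

Theorem theorem1 (R : realType) (d M n : nat)
    (F : 'I_M -> 'I_n -> 'rV[R]_d -> R) (L mu gamma eta : R) (C T : nat)
    (x0 xs : 'rV[R]_d) :
  (0 < M)%N -> (0 < n)%N ->
  (forall m i, differentiable_everywhere (F m i)) ->
  (forall m i, convex_fun (F m i)) ->
  (forall m i, smooth L (F m i)) ->
  smooth L (ftot F) ->
  0 < mu -> strongly_convex mu (ftot F) ->
  (forall y, ftot F xs <= ftot F y) ->
  0 < gamma -> 0 <= eta ->
  (1 <= C)%N -> (C <= M)%N ->
  gamma * n%:R <= eta -> eta <= (16 * L)^-1 ->
  (1 <= T)%N ->
  expect (R:=R) (M:=M) (n:=n) C (T:=T) (fun w => sqnorm (nastya_iterate F gamma eta C x0 w - xs))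
    <= (1 - eta * mu / 2) ^+ T * sqnorm (x0 - xs)
       + 5 * gamma ^+ 2 * n%:R * L / mu
           * (M%:R^-1 * \sum_(m < M) sigma_star_m2 F xs m + n%:R * sigma_star2 F xs)
       + 8 * eta / mu * ((M - C)%:R / (C%:R * (maxn (M - 1) 1)%:R))
           * sigma_star2 F xs.
Proof.
move=> _ n_gt0 diff_F convex_F smooth_F smooth_f mu_gt0 sconvex_f xs_min.
move=> gamma_gt0 _ C_gt0 CM gamma_eta eta_le _.
have eta_gt0 : 0 < eta by apply: lt_le_trans gamma_eta; rewrite mulr_gt0// ltr0n.
have L_gt0 : 0 < L by have := lt_le_trans eta_gt0 eta_le; rewrite invr_gt0 pmulr_rgt0.
have eta_small : 16 * L * eta <= 1.
  by move: eta_le; rewrite -[leRHS]mul1r ler_pdivlMr ?mulr_gt0// mulrC.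
rewrite -/(gradient_noise F xs) -/(@cohort_factor R M C) -addrA.
have error_le := limit_error_le F C xs n_gt0 L_gt0 gamma_gt0 gamma_eta mu_gt0.
have [mu_le|mu_gt] := leP mu L.
  have eta_mu_gt0 : 0 < eta * mu by rewrite mulr_gt0.
  have eta_mu_le : eta * mu <= eta * L by rewrite ler_pM2l.
  have C_bounds : (0 < C <= M)%N by rewrite C_gt0.
  apply: le_trans (nastya_convergence n_gt0 diff_F convex_F smooth_F sconvex_f
    xs_min L_gt0 gamma_gt0 gamma_eta _ mu_gt0 T x0 C_bounds _) _; [lra|lra|].
  by rewrite lerD// ler_wpM2r ?sqnorm_ge0// lerXn2r ?nnegrE//; lra.
(* This case only occurs for [d = 0]. *)
have dist0 x : sqnorm (x - xs) = 0.
  rewrite (smoothness_lt_strong_convexity_eq x (differentiable_ftot diff_F) smooth_f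
    sconvex_f xs_min mu_gt).
  by rewrite subrr sqnorm0.
rewrite /expect big1 => [|w _]; rewrite dist0// mul0r mulr0 add0r.
by apply: le_trans error_le; exact: limit_error_ge0.
Qed.
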